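(* Let $\mathbf{E}$ be a field and let $H$ be a subgroup of $\mathrm{Aut}(\mathbf{E})$. The following statements are equivalent: (i) the set of $H$-orbit lengths $\mathcal{L}_H=\{\ell(\mathcal{O}_H(\alpha))\mid\alpha\in\mathbf{E}\}$ is bounded above; (ii) there exists an element $\theta\in\mathbf{E}$, algebraic over $\mathbf{E}^H$, such that $\mathbf{E}=\mathbf{E}^H(\theta)$; (iii) the group $H$ is finite. Moreover, in that case: (iv) $H=\mathrm{Gal}(\mathbf{E}/\mathbf{E}^H)$; (v) $[H:1]=\ell(\mathcal{O}_H(\theta))$ for any $\theta$ as in (ii); and (vi) the primitive elements for the extension $\mathbf{E}/\mathbf{E}^H$ (the elements $\alpha\in\mathbf{E}$ with $\mathbf{E}=\mathbf{E}^H(\alpha)$) are precisely the elements $\alpha\in\mathbf{E}$ such that $\ell(\mathcal{O}_H(\alpha))=[H:1]$.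
   Context: $\mathrm{Aut}(\mathbf{E})$ is the group of all field automorphisms of $\mathbf{E}$. For a subgroup $H$ of $\mathrm{Aut}(\mathbf{E})$, the fixed field is $\mathbf{E}^H=\{\alpha\in\mathbf{E}\mid\sigma(\alpha)=\alpha\text{ for all }\sigma\in H\}$. For a subfield $\mathbf{F}$ of $\mathbf{E}$, $\mathrm{Gal}(\mathbf{E}/\mathbf{F})$ is the group of all $\sigma\in\mathrm{Aut}(\mathbf{E})$ that fix every element of $\mathbf{F}$. For $\alpha\in\mathbf{E}$, the $H$-orbit is $\mathcal{O}_H(\alpha)=\{\sigma(\alpha)\mid\sigma\in H\}$ and its length is the cardinality $\ell(\mathcal{O}_H(\alpha))=|\mathcal{O}_H(\alpha)|$, possibly infinite. ''$\mathcal{L}_H$ is bounded above'' means that there is a natural number $N$ such that every $H$-orbit is finite of length at most $N$. $[H:1]$ denotes the order of $H$. *)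

(* Defs.v *)
From mathcomp Require Import all_boot all_algebra.
From mathcomp Require Import mathcomp_extra boolp classical_sets functions cardinality.

Set Implicit Arguments.
Unset Strict Implicit.
Unset Printing Implicit Defensive.

Import GRing.Theory.

Local Open Scope classical_set_scope.
Local Open Scope card_scope.
Local Open Scope ring_scope.

(* Automorphisms are bare functions, so that equality of automorphisms is
   equality of functions and subgroups of Aut(E) are sets of functions. *)
Definition field_aut (E : fieldType) : set (E -> E) :=
  [set s : E -> E | [/\ bijective s, zmod_morphism s & monoid_morphism s]].

Definition subgroup_aut (E : fieldType) (H : set (E -> E)) : Prop :=
  [/\ H `<=` @field_aut E,
      H id,
      forall s t, H s -> H t -> H (s \o t) &
      forall s t, H s -> cancel s t -> cancel t s -> H t].

Definition fixed_field (E : fieldType) (H : set (E -> E)) : set E :=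
  [set a | forall s, H s -> s a = a].

Definition Gal (E : fieldType) (F : set E) : set (E -> E) :=
  [set s | field_aut s /\ forall a, F a -> s a = a].

Definition orbit_of (E : fieldType) (H : set (E -> E)) (a : E) : set E :=
  [set s a | s in H].

Definition orbit_lengths_bounded (E : fieldType) (H : set (E -> E)) : Prop :=
  exists N : nat, forall a : E,
    exists2 n : nat, (n <= N)%N & orbit_of H a #= `I_n.

Definition subfield (E : fieldType) (K : set E) : Prop :=
  divring_closed [in K].

Definition adjoin (E : fieldType) (F : set E) (a : E) : set E :=
  smallest (@subfield E) (F `|` [set a]).

Definition algebraic_over (E : fieldType) (F : set E) (a : E) : Prop :=
  exists p : {poly E}, [/\ p \is a polyOver [in F], p != 0 & root p a].

Definition primitive_element (E : fieldType) (F : set E) (a : E) : Prop :=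
  adjoin F a = [set: E].

(* Main.v *)
(** If [H] has bounded orbits, every [x] is a root of the product of the
    [X - b] over its orbit, whose coefficients are fixed by [H].  When [E] is
    finite, a generator of its multiplicative group is primitive.  Otherwise
    [F = E^H] is infinite, because the orbit polynomials have bounded degree;
    then an element [a] with an orbit of maximal length has a stabilizer that
    fixes every [x], for else [a + c x] would have a longer orbit for a suitable
    [c] in [F].  Lagrange interpolation through the points [(s a, s x)], [s] in
    [H], is [H]-invariant, hence writes [x] as an element of [F(a)].  Conversely,
    automorphisms agreeing on [F] and on a primitive element are equal, so
    evaluation at that element is injective on [H]; it takes its values among
    the roots of any polynomial over [F] vanishing there. *)

From HB Require Import structures.
Require Import Defs.
From mathcomp Require Import all_boot all_algebra finmap cyclic.
From mathcomp Require Import mathcomp_extra boolp classical_sets functions cardinality.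

Import GRing.Theory.

Local Open Scope classical_set_scope.
Local Open Scope card_scope.
Local Open Scope ring_scope.

Set Implicit Arguments.
Unset Strict Implicit.

(** * Finite sets as duplicate-free sequences; automorphisms and orbits *)

Lemma card_eq_seqP (T : choiceType) (A : set T) (n : nat) :
  A #= `I_n <-> exists t : seq T, [/\ uniq t, size t = n & A = [set` t]].
Proof.
split=> [An|[t [ut <- ->]]].
  have /finite_fsetP[X AX] : finite_set A by apply/finite_setP; exists n.
  exists X; split; [exact: fset_uniq | | exact: AX].
  by apply/card_eq_fsetP; rewrite -AX.
have -> : [set` t] = [set` seq_fset tt t].
  by apply/seteqP; split=> x /=; have /= -> := seq_fsetE tt t x.
by apply/card_eq_fsetP; rewrite size_seq_fset undup_id.
Qed.

Lemma field_aut_rmorph (E : fieldType) (s : E -> E) :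
  field_aut s -> exists f : {rmorphism E -> E}, s = f.
Proof.
move=> [_ sB sM].
pose f : {rmorphism E -> E} := HB.pack s
  (GRing.isZmodMorphism.Build E E s sB) (GRing.isMonoidMorphism.Build E E s sM).
by exists f.
Qed.

Lemma subgroup_aut_inv (E : fieldType) (H : set (E -> E)) (s : E -> E) :
  subgroup_aut H -> H s -> exists t, [/\ H t, cancel s t & cancel t s].
Proof.
move=> [Haut _ _ HV] Hs; have [[t st ts] _ _] := Haut _ Hs.
by exists t; split=> //; apply: HV ts.
Qed.

Lemma orbit_stable (E : fieldType) (H : set (E -> E)) (s : E -> E) (a b : E) :
  subgroup_aut H -> H s -> orbit_of H a b -> orbit_of H a (s b).
Proof. by move=> [_ _ HM _] Hs [t Ht <-]; exists (s \o t) => //; apply: HM. Qed.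

(** An injection of a finite set into itself is a permutation. Hence symmetric expressions in the
    points of an orbit are [H]-invariant. *)
Lemma perm_orbit (E : fieldType) (H : set (E -> E)) (s : E -> E) (a : E)
    (t : seq E) :
  subgroup_aut H -> H s -> uniq t -> orbit_of H a = [set` t] ->
  perm_eq (map s t) t.
Proof.
move=> Hgp Hs ut at_; have [Haut _ _ _] := Hgp.
have [/bij_inj sI _ _] := Haut _ Hs.
have ust : uniq (map s t) by rewrite map_inj_uniq.
apply: uniq_perm => //; apply: (uniq_min_size ust _ _).2.
  move=> _ /mapP[b bt ->]; have : orbit_of H a b by rewrite at_.
  by move/(orbit_stable Hgp Hs); rewrite at_.
by rewrite size_map.
Qed.

(** * Subfields and automorphisms agreeing on them *)

Lemma subfield_divring (E : fieldType) (K : set E) :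
  subfield K -> exists S : divringClosed E, forall x, (x \in S) = (x \in K).
Proof.
move=> hK.
pose S : divringClosed E :=
  HB.pack [in K] (GRing.isDivringClosed.Build E [in K] hK).
by exists S.
Qed.

Lemma polyOver_setP (R : nzSemiRingType) (F : set R) (p : {poly R}) :
  F 0 -> p \is a polyOver [in F] <-> forall i, F p`_i.
Proof.
move=> F0; rewrite qualifE; split=> [/allP pF i|pF].
  have [/(mem_nth 0)/pF/set_mem//|/(nth_default 0)->//] := ltnP i (size p).
by apply/(all_nthP 0) => i _; apply/mem_set/pF.
Qed.

Lemma fixed_field0 (E : fieldType) (H : set (E -> E)) :
  subgroup_aut H -> fixed_field H 0.
Proof.
by move=> [Haut _ _ _] s /Haut/field_aut_rmorph[f ->]; rewrite rmorph0.
Qed.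

Lemma subfield_horner (E : fieldType) (F K : set E) (p : {poly E}) (a : E) :
  subfield K -> F 0 -> F `<=` K -> K a -> p \is a polyOver [in F] -> K p.[a].
Proof.
move=> /subfield_divring[S SK] F0 FK Ka /(polyOver_setP _ F0) pF.
apply: set_mem; rewrite -SK; apply: rpred_horner; last by rewrite SK mem_set.
by apply/polyOverP => i; rewrite SK; apply/mem_set/FK/pF.
Qed.

Lemma eq_aut_subfield (E : fieldType) (s t : E -> E) :
  field_aut s -> field_aut t -> subfield [set x | s x = t x].
Proof.
move=> /field_aut_rmorph[f ->] /field_aut_rmorph[g ->].
split; first by rewrite inE /= !rmorph1.
- by move=> x y; rewrite !inE /= !rmorphB => -> ->.
- by move=> x y; rewrite !inE /= !fmorph_div => -> ->.
Qed.

(** The equalizer of two automorphisms is a subfield; here it contains [F] and [a], so it is all of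
    [E]. *)
Lemma eq_aut_primitive (E : fieldType) (F : set E) (s t : E -> E) (a : E) :
  field_aut s -> field_aut t -> primitive_element F a ->
  (forall x, F x -> s x = t x) -> s a = t a -> s = t.
Proof.
move=> sA tA Fa stF sta; apply/funext => x.
have /(_ [set y | s y = t y]) : adjoin F a x by rewrite Fa.
apply; split; first exact: eq_aut_subfield.
by move=> y [/stF//|->].
Qed.

Lemma inj_eval_primitive (E : fieldType) (H : set (E -> E)) (a : E) :
  subgroup_aut H -> primitive_element (fixed_field H) a ->
  {in H &, injective (fun s : E -> E => s a)}.
Proof.
move=> [Haut _ _ _] Fa s t /set_mem Hs /set_mem Ht.
apply: eq_aut_primitive (Haut _ Hs) (Haut _ Ht) Fa _ => x Fx.
by rewrite Fx// Fx.
Qed.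

(** * Polynomials over the fixed field, and Lagrange interpolation *)

Lemma polyOver_fixed (E : fieldType) (H : set (E -> E)) (p : {poly E}) :
  subgroup_aut H -> (forall f : {rmorphism E -> E}, H f -> map_poly f p = p) ->
  p \is a polyOver [in fixed_field H].
Proof.
move=> Hgp pH; apply/(polyOver_setP _ (fixed_field0 Hgp)) => i s Hs.
have [Haut _ _ _] := Hgp; have [f sf] := field_aut_rmorph (Haut _ Hs).
by rewrite sf -coef_map pH// -sf.
Qed.

Lemma orbit_poly_over (E : fieldType) (H : set (E -> E)) (a : E) (t : seq E) :
  subgroup_aut H -> uniq t -> orbit_of H a = [set` t] ->
  \prod_(b <- t) ('X - b%:P) \is a polyOver [in fixed_field H].
Proof.
move=> Hgp ut at_; apply: polyOver_fixed => // f Hf.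
rewrite rmorph_prod -[RHS](perm_big _ (perm_orbit Hgp Hf ut at_)) big_map /=.
by apply: eq_bigr => b _; rewrite rmorphB /= map_polyX map_polyC.
Qed.

(** The numerator of the Lagrange interpolant of [h] on [t], written so that its
    invariance needs only a permutation of [t].  At a node [a] the factor other
    than [h a] does not depend on [h], so dividing by the case [h = 1] recovers
    [h a]. *)
Definition lagrange (E : fieldType) (t : seq E) (h : E -> E) : {poly E} :=
  \sum_(b <- t) h b *: \prod_(c <- t | c != b) ('X - c%:P).

Lemma lagrange_horner (E : fieldType) (t : seq E) (h : E -> E) (a : E) :
  uniq t -> a \in t ->
  (lagrange t h).[a] = h a * \prod_(c <- t | c != a) (a - c).
Proof.
move=> ut at_; rewrite /lagrange horner_sum (bigD1_seq a)//=.
rewrite [X in _ + X]big1 ?addr0 => [|b ba].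
  rewrite hornerZ horner_prod; congr (_ * _).
  by apply: eq_bigr => c _; rewrite hornerXsubC.
rewrite hornerZ horner_prod (big_rem a)//= eq_sym ba hornerXsubC subrr.
by rewrite mul0r mulr0.
Qed.

(** Since [h] is equivariant on the orbit, an element of [H] carries the summand at [b] to the
    summand at the image of [b], so it only permutes the sum. *)
Lemma lagrange_over (E : fieldType) (H : set (E -> E)) (h : E -> E) (a : E)
    (t : seq E) :
  subgroup_aut H -> uniq t -> orbit_of H a = [set` t] ->
  (forall s b, H s -> orbit_of H a b -> h (s b) = s (h b)) ->
  lagrange t h \is a polyOver [in fixed_field H].
Proof.
move=> Hgp ut at_ hH; apply: polyOver_fixed => // f Hf; have pf := perm_orbit Hgp Hf ut at_.
rewrite /lagrange rmorph_sum -[RHS](perm_big _ pf) big_map /=.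
apply: eq_big_seq => b bt; rewrite map_polyZ rmorph_prod hH ?at_//.
rewrite -[in RHS](perm_big _ pf) big_map /=; congr (_ *: _).
by apply: eq_big => c; rewrite ?(inj_eq (fmorph_inj f))// rmorphB /=
  map_polyX map_polyC.
Qed.

(** As the stabilizer of [a] fixes [x], the rule sending [s a] to [s x] is well defined and
    equivariant on the orbit. Interpolating it writes [x] as a quotient of values at [a] of
    polynomials over the fixed field. *)
Lemma mem_adjoin_fixed (E : fieldType) (H : set (E -> E)) (a x : E) :
  subgroup_aut H -> finite_set (orbit_of H a) ->
  (forall s, H s -> s a = a -> s x = x) -> adjoin (fixed_field H) a x.
Proof.
move=> Hgp /finite_setP[n /card_eq_seqP[t [ut _ at_]]] ax.
have [Haut H1 HM _] := Hgp.
(* The default [0] is taken only outside the orbit of [a]. *)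
pose h b := xget 0 [set s x | s in [set s | H s /\ s a = b]].
have hE s : H s -> h (s a) = s x.
  move=> Hs; rewrite /h; case: xgetP => [_ -> [u [Hu ua] <-]|]; last first.
    by move=> /(_ (s x)) /=; case; exists s.
  (* Two choices [u] and [s] over the same point differ by the element [v \o u] of the stabilizer of
     [a]. *)
  have [v [Hv sv vs]] := subgroup_aut_inv Hgp Hs.
  rewrite -[LHS]vs; congr (s _); apply: (ax (v \o u)); first exact: HM.
  by rewrite /= ua sv.
have at1 : a \in t by have : orbit_of H a a; [exists id | rewrite at_].
have ph : lagrange t h \is a polyOver [in fixed_field H].
  apply: lagrange_over at_ _ => // s _ Hs [u Hu <-].
  by rewrite (hE u)// (hE (s \o u))//; apply: HM.
have p1 : lagrange t (fun=> 1) \is a polyOver [in fixed_field H].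
  apply: lagrange_over at_ _ => // s b Hs _.
  by have [f ->] := field_aut_rmorph (Haut _ Hs); rewrite rmorph1.
have F0 := fixed_field0 Hgp.
have -> : x = (lagrange t h).[a] / (lagrange t (fun=> 1)).[a].
  rewrite !lagrange_horner// (hE _ H1) mul1r mulfK// prodf_seq_neq0.
  by apply/allP => c _; apply/implyP; rewrite subr_eq0 eq_sym.
move=> K [/= hK FaK]; have [S SK] := subfield_divring hK.
have FK : fixed_field H `<=` K by move=> y Fy; apply: FaK; left.
have Ka : K a by apply: FaK; right.
by apply: set_mem; rewrite -SK; apply: rpred_div; rewrite SK;
  apply: mem_set; apply: subfield_horner F0 FK _ _.
Qed.

(** * Finiteness of sets of roots and polynomials; finite fields *)

Lemma uniq_map_inj_in (T U : eqType) (f : T -> U) (t : seq T) :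
  uniq (map f t) -> {in t &, injective f}.
Proof.
elim: t => //= z t IH /andP[zt ut] x y; rewrite !inE.
have fN w : w \in t -> f z <> f w by move=> wt zw; rewrite zw map_f in zt.
by move=> /orP[/eqP->|xt] /orP[/eqP->|yt] // => [/(fN _ yt)|/esym/(fN _ xt)|/IH->].
Qed.

Lemma finite_roots (R : idomainType) (p : {poly R}) :
  p != 0 -> finite_set [set x | root p x].
Proof.
move=> p0; apply: contrapT => /(@infinite_set_fset _ _ (size p))[B Bp sB].
have := max_poly_roots p0 (rs := B) _ (fset_uniq B).
rewrite ltnNge sB => /(_ _)/negP; case=> //.
by apply/allP => x /Bp.
Qed.

Lemma finite_polyOver (R : nzSemiRingType) (F : set R) (n : nat) :
  finite_set F ->
  finite_set [set p : {poly R} | (size p <= n)%N /\ forall i, F p`_i].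
Proof.
move=> finF; elim: n => [|n IH].
  apply: sub_finite_set (finite_set1 0) => p [].
  by rewrite leqn0 size_poly_eq0 => /eqP->.
apply: sub_finite_set (finite_image (fun q => q.2 * 'X + q.1%:P)
  (finite_setX finF IH)) => p [sp pF].
exists (p`_0, drop_poly 1 p) => /=.
  split=> //; split=> [|i]; last by rewrite coef_drop_poly.
  by rewrite size_drop_poly leq_subLR.
apply/polyP => -[|i]; rewrite coefD coefMX coefC /= ?add0r//.
by rewrite coef_drop_poly addn1 addr0.
Qed.

Lemma finite_field_generator (E : fieldType) :
  finite_set [set: E] -> exists z : E, forall x, x != 0 -> exists i, x = z ^+ i.
Proof.
move=> finE.
have /finite_setP[n /card_eq_seqP[t [ut st tE]]] :
    finite_set [set x : E | x != 0].
  exact: sub_finite_set finE.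
have tP x : (x \in t) = (x != 0).
  by apply/idP/idP => [xt|x0]; [have : [set` t] x by [] |
    have : [set x | x != 0] x by []]; rewrite ?tE// -tE.
(* Multiplication by [x] permutes the nonzero elements, so it leaves their product unchanged; that
   product is also scaled by [x ^+ n]. *)
have xn x : x \in t -> x ^+ n = 1.
  rewrite tP => x0; have prod0 : \prod_(y <- t) y != 0.
    by rewrite prodf_seq_neq0; apply/allP => y; rewrite tP.
  apply: (mulIf prod0); rewrite mul1r.
  have -> : x ^+ n = \prod_(y <- t) x.
    by rewrite big_const_seq count_predT st iter_mulr_1.
  rewrite -big_split -(big_map (GRing.mul x) predT id) /=.
  have uxt : uniq (map (GRing.mul x) t) by rewrite map_inj_uniq//; apply: mulfI.
  apply: perm_big; apply: uniq_perm => //.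
  apply: (uniq_min_size uxt _ _).2; last by rewrite size_map.
  by move=> _ /mapP[y yt ->]; rewrite tP mulf_neq0 -?tP// tP.
have n0 : (0 < n)%N.
  by rewrite -st -has_predT; apply/hasP; exists 1; rewrite ?tP ?oner_eq0.
have /hasP[z _ zn] : has n.-primitive_root t.
  apply: has_prim_root => //; last by rewrite st.
  by apply/allP => x /xn ?; apply/unity_rootP.
exists z => x; rewrite -tP => /xn/(prim_rootP zn)[i ->]; by exists i.
Qed.

(** * From bounded orbits to a primitive element *)

Lemma finite_orbit_algebraic (E : fieldType) (H : set (E -> E)) (a : E) :
  subgroup_aut H -> finite_set (orbit_of H a) ->
  algebraic_over (fixed_field H) a.
Proof.
move=> Hgp /finite_setP[n /card_eq_seqP[t [ut _ at_]]].
exists (\prod_(b <- t) ('X - b%:P)); split; first exact: orbit_poly_over at_.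
  exact/monic_neq0/monic_prod_XsubC.
rewrite root_prod_XsubC; have [_ H1 _ _] := Hgp.
by have : orbit_of H a a; [exists id | rewrite at_].
Qed.

(** Orbit polynomials have degree at most [N], hence size at most [N.+1]. Over a finite fixed field
    there are finitely many such polynomials, and their roots exhaust [E]. *)
Lemma finite_field_of_finite_fixed (E : fieldType) (H : set (E -> E)) :
  subgroup_aut H -> orbit_lengths_bounded H -> finite_set (fixed_field H) ->
  finite_set [set: E].
Proof.
move=> Hgp [N HN] /(finite_polyOver N.+1) finP.
set P := [set p : {poly E} | _] in finP.
apply: (@sub_finite_set _ _
  (\bigcup_(p in P `&` [set p | p != 0]) [set x | root p x])).
  move=> x _; have [n nN /card_eq_seqP[t [ut st xt]]] := HN x.
  exists (\prod_(b <- t) ('X - b%:P)); first split; first split.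
  - by rewrite size_prod_XsubC st.
  - apply/polyOver_setP; [exact: fixed_field0 | exact: orbit_poly_over xt].
  - exact/monic_neq0/monic_prod_XsubC.
  rewrite /= root_prod_XsubC; have [_ H1 _ _] := Hgp.
  by have : orbit_of H x x; [exists id | rewrite xt].
apply: bigcup_finite => [|p [_ p0]]; last exact: finite_roots.
exact: finite_setIl.
Qed.

(** For a suitable fixed [c], the pairs [(u a, u x)] inject into the orbit of [a + c * x], so there
    are at most [n] of them. They project onto the orbit of [a], which has [n] points, so [u a]
    determines [u x]. *)
Lemma stab_max_orbit (E : fieldType) (H : set (E -> E)) (a x : E) (n : nat)
    (s : E -> E) :
  subgroup_aut H -> infinite_set (fixed_field H) -> orbit_of H a #= `I_n ->
  (forall y, exists2 m, (m <= n)%N & orbit_of H y #= `I_m) ->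
  H s -> s a = a -> s x = x.
Proof.
move=> Hgp infF /card_eq_seqP[t [ut st at_]] maxn_ Hs sa.
have [Haut H1 _ _] := Hgp.
pose P := [set (u a, u x) | u in H].
have finP : finite_set P.
  apply: (@sub_finite_set _ _ (orbit_of H a `*` orbit_of H x)).
    by move=> _ [u Hu <-]; split; exists u.
  apply: finite_setX; first by rewrite at_; exact: finite_seq.
  by have [m _ xm] := maxn_ x; apply/finite_setP; exists m.
have finB := finite_image (fun q : (E * E) * (E * E) =>
  (q.1.1 - q.2.1) / (q.2.2 - q.1.2)) (finite_setX finP finP).
set B := (X in finite_set X) in finB.
(* [B] contains every [c] with [q |-> q.1 + c q.2] not injective on [P]. *)
have [c [Fc Bc]] : exists c, fixed_field H c /\ ~ B c.
  apply: contrapT => nc; apply: infF; apply: sub_finite_set finB => c Fc.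
  by apply: contrapT => Bc; apply: nc; exists c.
have /finite_setP[k /card_eq_seqP[pp [upp _ PE]]] := finP.
have PP q : P q -> q \in pp by rewrite PE.
have phiI : {in pp &, injective (fun q : E * E => q.1 + c * q.2)}.
  move=> q r qp rp /= qr; have Pq : P q by rewrite PE.
  have Pr : P r by rewrite PE.
  have [e2|ne2] := eqVneq q.2 r.2.
    move: qr; rewrite e2 => /addIr e1.
    by case: q r e1 e2 {qp rp Pq Pr} => [? ?] [? ?] /= -> ->.
  case: Bc; exists (q, r) => //=; apply: (canLR (mulfK _)).
    by rewrite subr_eq0 eq_sym.
  by apply/eqP; rewrite mulrBr subr_eq addrAC eq_sym subr_eq addrC -qr addrC.
have [m mn /card_eq_seqP[u [uu su uE]]] := maxn_ (a + c * x).
have pt : (size pp <= size t)%N.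
  rewrite -(size_map (fun q : E * E => q.1 + c * q.2)).
  rewrite st (leq_trans _ mn)// -su; apply: uniq_leq_size.
    by rewrite map_inj_in_uniq.
  move=> _ /mapP[q qp ->]; have : P q by rewrite PE.
  move=> [v Hv <-] /=.
  suff : orbit_of H (a + c * x) (v a + c * v x) by rewrite uE.
  exists v => //; have := Fc _ Hv; have [f ->] := field_aut_rmorph (Haut _ Hv).
  by move=> fc; rewrite rmorphD rmorphM fc.
have ufst : uniq (map fst pp).
  apply: (leq_size_uniq ut); last by rewrite size_map.
  move=> b bt; have : orbit_of H a b by rewrite at_.
  by move=> [v Hv <-]; apply/mapP; exists (v a, v x) => //; apply: PP; exists v.
have : (s a, s x) = (a, x).
  by apply: (uniq_map_inj_in ufst) => //; apply: PP; [exists s | exists id].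
by case.
Qed.

Lemma primitive_of_fixed_stab (E : fieldType) (H : set (E -> E)) (a : E) :
  subgroup_aut H -> finite_set (orbit_of H a) ->
  (forall s x, H s -> s a = a -> s x = x) -> primitive_element (fixed_field H) a.
Proof.
move=> Hgp fina stab; apply/seteqP; split=> // x _.
by apply: mem_adjoin_fixed => // s; apply: stab.
Qed.

Lemma primitive_of_bounded (E : fieldType) (H : set (E -> E)) :
  subgroup_aut H -> orbit_lengths_bounded H ->
  exists a, algebraic_over (fixed_field H) a /\
    primitive_element (fixed_field H) a.
Proof.
move=> Hgp HN.
have finO a : finite_set (orbit_of H a).
  by have [N /(_ a)[n _ an]] := HN; apply/finite_setP; exists n.
suff [a Fa] : exists a, primitive_element (fixed_field H) a.
  by exists a; split=> //; apply: finite_orbit_algebraic.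
have [finE|infE] := pselect (finite_set [set: E]).
  have [z zE] := finite_field_generator finE.
  exists z; apply/seteqP; split=> // x _ K [/= hK FK].
  have [S SK] := subfield_divring hK; apply: set_mem; rewrite -SK.
  have [->|/zE[i ->]] := eqVneq x 0; first exact: rpred0.
  by apply: rpredX; rewrite SK; apply/mem_set/FK; right.
have infF : infinite_set (fixed_field H).
  by move=> finF; apply/infE/(finite_field_of_finite_fixed Hgp).
(* The bound [N] may not be attained; the largest length that does occur is needed. *)
have [N maxN] := HN; pose Q n := `[< exists a, orbit_of H a #= `I_n >].
have exQ : exists n, Q n by have [n _ ?] := maxN 0; exists n; apply/asboolP; exists 0.
have leQ n : Q n -> (n <= N)%N.
  move=> /asboolP[a an]; have [m mN am] := maxN a.
  suff -> : n = m by [].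
  by apply/card_eq_II; apply: card_eq_trans am; rewrite card_eq_sym.
case: (ex_maxnP exQ leQ) => n /asboolP[a an] nmax.
exists a; apply: primitive_of_fixed_stab => // s x Hs.
apply: (stab_max_orbit _ Hgp infF an _ Hs) => y.
have [m _ ym] := maxN y; exists m => //; apply: nmax.
by apply/asboolP; exists y.
Qed.

(** * From a primitive element to the finiteness of [H] and the Galois group *)

Lemma root_fixed_poly (E : fieldType) (F : set E) (s : E -> E) (p : {poly E})
    (a : E) :
  F 0 -> Gal F s -> p \is a polyOver [in F] -> root p a -> root p (s a).
Proof.
move=> F0 [/field_aut_rmorph[f ->] fF] /(polyOver_setP _ F0) pF pa.
suff <- : map_poly f p = p by exact: rmorph_root.
by apply/polyP => i; rewrite coef_map; apply: fF.
Qed.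

Lemma sub_Gal_fixed (E : fieldType) (H : set (E -> E)) :
  subgroup_aut H -> H `<=` Gal (fixed_field H).
Proof. by move=> [Haut _ _ _] s Hs; split=> [|x]; [exact: Haut | exact]. Qed.

Lemma finite_of_primitive (E : fieldType) (H : set (E -> E)) (a : E) :
  subgroup_aut H -> algebraic_over (fixed_field H) a ->
  primitive_element (fixed_field H) a -> finite_set H.
Proof.
move=> Hgp [p [pF p0 pa]] Fa.
rewrite -(eq_finite_set (inj_card_eq (inj_eval_primitive Hgp Fa))).
apply: sub_finite_set (finite_roots p0) => _ [s Hs <-].
apply: (root_fixed_poly (fixed_field0 Hgp)) pF pa.
exact: sub_Gal_fixed.
Qed.

Lemma bounded_of_finite (E : fieldType) (H : set (E -> E)) :
  finite_set H -> orbit_lengths_bounded H.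
Proof.
move=> finH; have /finite_setP[N /card_eq_seqP[t [_ st HE]]] := finH.
exists N => a; have /finite_setP[n an] := finite_image (fun s => s a) finH.
exists n => //; have /card_eq_seqP[u [uu <- uE]] := an.
rewrite -st -(size_map (fun s : E -> E => s a)); apply: uniq_leq_size => // b bu.
have [s Hs <-] : orbit_of H a b by rewrite /orbit_of uE.
by apply: (map_f (fun s : E -> E => s a)); rewrite HE in Hs.
Qed.

(** Evaluation at [a] maps [H] onto the orbit, and a surjection between finite sets of equal size is
    injective. *)
Lemma inj_eval_card (E : fieldType) (H : set (E -> E)) (a : E) :
  finite_set H -> orbit_of H a #= H ->
  {in H &, injective (fun s : E -> E => s a)}.
Proof.
move=> /finite_setP[n Hn] aH.
have /card_eq_seqP[u [uu su uE]] := card_eq_trans aH Hn.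
have /card_eq_seqP[t [_ st HE]] := Hn.
have ut : uniq (map (fun s : E -> E => s a) t).
  apply: (leq_size_uniq uu); last by rewrite size_map st su.
  move=> b bu; have [s Hs <-] : orbit_of H a b by rewrite uE.
  by apply: (map_f (fun s : E -> E => s a)); rewrite HE in Hs.
move=> r s /set_mem Hr /set_mem Hs; rewrite HE in Hr Hs.
exact: (uniq_map_inj_in ut).
Qed.

(** An element of the Galois group sends [a] to a root of its orbit polynomial, so it agrees at [a]
    with some [u] in [H]; being equal on the fixed field too, the two coincide. *)
Lemma Gal_fixed_primitive (E : fieldType) (H : set (E -> E)) (a : E) :
  subgroup_aut H -> finite_set (orbit_of H a) ->
  primitive_element (fixed_field H) a -> H = Gal (fixed_field H).
Proof.
move=> Hgp /finite_setP[n /card_eq_seqP[t [ut _ at_]]] Fa.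
apply/seteqP; split=> [|s sG]; first exact: sub_Gal_fixed.
have [Haut H1 _ _] := Hgp; have [sA sF] := sG.
have [u Hu ua] : orbit_of H a (s a).
  have : root (\prod_(b <- t) ('X - b%:P)) (s a).
    apply: (root_fixed_poly (fixed_field0 Hgp)) sG _ _.
      exact: orbit_poly_over at_.
    by rewrite root_prod_XsubC; have : orbit_of H a a; [exists id | rewrite at_].
  by rewrite root_prod_XsubC at_.
rewrite (eq_aut_primitive sA (Haut _ Hu) Fa)// => x Fx.
by rewrite sF// Fx.
Qed.

Theorem theorem5p1 (E : fieldType) (H : set (E -> E)) (hH : subgroup_aut H) :
  let F := fixed_field H in
  [/\ orbit_lengths_bounded H <->
        (exists theta : E, algebraic_over F theta /\ primitive_element F theta),
      (exists theta : E, algebraic_over F theta /\ primitive_element F theta) <->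
        finite_set H &
      finite_set H ->
        [/\ H = Gal F,
            forall theta : E, algebraic_over F theta ->
              primitive_element F theta -> H #= orbit_of H theta &
            forall a : E, primitive_element F a <-> orbit_of H a #= H]].
Proof.
move=> F.
have fin_of_prim : (exists a, algebraic_over F a /\ primitive_element F a) ->
    finite_set H.
  by move=> [a [alga Fa]]; exact: finite_of_primitive alga Fa.
have bdd_of_fin := @bounded_of_finite E H.
have card_orbit a : primitive_element F a -> orbit_of H a #= H.
  by move=> Fa; apply/inj_card_eq/inj_eval_primitive.
split; first by split=> [/(primitive_of_bounded hH)|/fin_of_prim].
  by split=> // /bdd_of_fin/(primitive_of_bounded hH).
move=> finH; have finO a : finite_set (orbit_of H a) by exact: finite_image.
split.
- have [a [_ Fa]] := primitive_of_bounded hH (bdd_of_fin finH).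
  exact: Gal_fixed_primitive Fa.
- by move=> a _ Fa; rewrite card_eq_sym; exact: card_orbit.
- move=> a; split=> [|aH]; first exact: card_orbit.
  (* Here [s] and [id] take the same value at [a], so injectivity of evaluation on [H] makes the
     stabilizer of [a] trivial. *)
  apply: primitive_of_fixed_stab => // s x Hs sa.
  have [_ H1 _ _] := hH.
  by rewrite (inj_eval_card finH aH (mem_set Hs) (mem_set H1) sa).
Qed.
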